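(* Let $n\ge 3$ and let $S\subset[n-1]$ be a nonempty proper subset. Then \[\max\{d_H(\sigma,\rho):\sigma,\rho\in\mathcal{D}(S;n),\ \sigma\ne\rho\}=\begin{cases} n-1 & \text{if } S=\{i,i+1,\ldots,j\} \text{ (a set of consecutive integers) with } i=1 \text{ or } j=n-1,\\ n & \text{otherwise.}\end{cases}\]
   Context: $[m]=\{1,\ldots,m\}$. $S_n$ is the symmetric group on $[n]$, with permutations in one-line notation $\sigma=\sigma_1\cdots\sigma_n$. The descent set of $\sigma$ is $\mathcal{D}(\sigma)=\{i\in[n-1]:\sigma_i>\sigma_{i+1}\}$, and for $S\subseteq[n-1]$, $\mathcal{D}(S;n)=\{\sigma\in S_n:\mathcal{D}(\sigma)=S\}$. The Hamming metric is $d_H(\sigma,\rho)=|\{i\in[n]:\sigma_i\ne\rho_i\}|$. *)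

(* Defs.v *)
From mathcomp Require Import all_boot all_fingroup.
Set Implicit Arguments.
Unset Strict Implicit.
Unset Printing Implicit Defensive.

(* All indices are shifted down by one: 'I_n stands for [n] and 'I_n.-1 for
   [n-1], the ordinal of value i representing the integer i.+1. *)

Definition pos n (i : 'I_n.-1) : 'I_n := widen_ord (leq_pred n) i.

(* [lift (pos i) i] has value [bump i i], i.e. [i.+1]. *)
Definition next_pos n (i : 'I_n.-1) : 'I_n := lift (pos i) i.

Definition descent_set n (s : 'S_n) : {set 'I_n.-1} :=
  [set i | s (next_pos i) < s (pos i)].

Definition descent_class n (S : {set 'I_n.-1}) : {set 'S_n} :=
  [set s | descent_set s == S].

Definition hamming n (s r : 'S_n) : nat := #|[set i | s i != r i]|.

(* S = {i, ..., j} with i = 1 or j = n-1, in the shifted indexing. *)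
Definition end_interval n (S : {set 'I_n.-1}) : bool :=
  [exists i : 'I_n.-1, exists j : 'I_n.-1,
    [&& i <= j, S == [set k : 'I_n.-1 | i <= k <= j]
      & (i.+1 == 1) || (j.+1 == n.-1)]].

(* Main.v *)
Require Import Defs.
From mathcomp Require Import all_boot all_fingroup.
From mathcomp Require Import zify.
Set Implicit Arguments.
Unset Strict Implicit.
Unset Printing Implicit Defensive.

(* Read S as a word with letters D (descent) and A (ascent). If S is an end
   interval, the word is D^k A^l or A^k D^l, so the permutation takes an extremal
   value at the turning point, and two explicit permutations differ everywhere
   else. Otherwise the word contains a factor A D^k A or D A^k D, for which two
   everywhere different permutations are explicit. Such a pair survives adding a
   letter at either end of the word: for a final A, see [deranged_ascent]; the
   other cases follow by complement and reversal. *)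

(** * Words, their realizations, and letters added at either end *)

(** Permutations are encoded as functions on [nat], so that explicit ones can be checked by [lia].
    Only the values of [f] below [n] and the first [n.-1] letters of [w] matter. *)
Definition realizes n (w : nat -> bool) (f : nat -> nat) : Prop :=
  [/\ forall i, i < n -> f i < n,
      forall i j, i < n -> j < n -> f i = f j -> i = j
    & forall i, i.+1 < n -> (f i.+1 < f i) = w i].

Definition deranged n (w : nat -> bool) : Prop :=
  exists f g, [/\ realizes n w f, realizes n w g
                & forall i, i < n -> f i <> g i].

Lemma realizes_compl n w f :
  realizes n w f -> realizes n (fun i => ~~ w i) (fun i => n.-1 - f i).
Proof.
case=> lt_f inj_f desc_f; split=> [i|i j ltin ltjn|i ltin].
- lia.
- have := lt_f i ltin; have := lt_f j ltjn => ? ? ?; apply: inj_f => //; lia.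
- have ltin' := ltnW ltin; have := lt_f i ltin'; have := lt_f i.+1 ltin.
  have := inj_f i i.+1 ltin' ltin; rewrite -desc_f //; lia.
Qed.

(** Reversal sends positions [i], [i.+1] to [n - i.+1], [n - i.+2]; so it reverses the word and
    exchanges ascents with descents. *)
Lemma realizes_rev n w f :
  realizes n w f -> realizes n (fun i => ~~ w (n - i.+2)) (fun i => f (n - i.+1)).
Proof.
case=> lt_f inj_f desc_f; split=> [i ltin|i j ltin ltjn eq_f|i ltin].
- apply: lt_f; lia.
- have := inj_f (n - i.+1) (n - j.+1); lia.
- have ->: n - i.+1 = (n - i.+2).+1 by lia.
  have := inj_f (n - i.+2) (n - i.+2).+1; rewrite -desc_f; lia.
Qed.

Lemma eq_realizes n w w' f :
  (forall i, i.+1 < n -> w i = w' i) -> realizes n w f -> realizes n w' f.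
Proof.
by move=> eq_w [? ? desc_f]; split=> // i ltin; rewrite desc_f // eq_w.
Qed.

Lemma eq_deranged n w w' :
  (forall i, i.+1 < n -> w i = w' i) -> deranged n w -> deranged n w'.
Proof.
by move=> eq_w [f [g [? ? ?]]]; exists f, g; split=> //; apply: eq_realizes eq_w _.
Qed.

Lemma deranged_compl n w : deranged n w -> deranged n (fun i => ~~ w i).
Proof.
case=> f [g [rf rg neq]].
exists (fun i => n.-1 - f i), (fun i => n.-1 - g i).
split; try exact: realizes_compl.
case: rf rg => [lt_f _ _] [lt_g _ _] i ltin.
by have := neq i ltin; have := lt_f i ltin; have := lt_g i ltin; lia.
Qed.

Lemma deranged_rev n w : deranged n w -> deranged n (fun i => ~~ w (n - i.+2)).
Proof.
case=> f [g [rf rg neq]].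
exists (fun i => f (n - i.+1)), (fun i => g (n - i.+1)).
split; try exact: realizes_rev.
by move=> i ltin; apply: neq; lia.
Qed.

(* As [f] and [g] differ at [m.-1], one of them, say [g], does not end with the
   largest value. Append [m] to [f]; append [m.-1] to [g], after raising its
   former value [m.-1] to [m], which the new [f] takes only at the end. *)
Lemma deranged_ascent m w :
  0 < m -> w m.-1 = false -> deranged m w -> deranged m.+1 w.
Proof.
move=> m_gt0 wm [f [g [rf rg neq]]].
wlog g_last: f g rf rg neq / g m.-1 < m.-1.
  move=> W; have [|g_last] := ltnP (g m.-1) m.-1; first exact: W rf rg neq.
  apply: (W g f) => // [i ltim|]; first by move/esym; apply: neq.
  case: rf rg => [lt_f _ _] [lt_g _ _].
  by have := neq m.-1; have := lt_f m.-1; have := lt_g m.-1; lia.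
case: rf rg => [lt_f inj_f desc_f] [lt_g inj_g desc_g].
exists (fun i => if i == m then m else f i).
exists (fun i => if i == m then m.-1 else if g i == m.-1 then m else g i).
split; [split | split | ].
- by move=> i ltim; have := lt_f i; repeat (case: ifP => ?); lia.
- move=> i j ltim ltjm; have := lt_f i; have := lt_f j; have := inj_f i j.
  by repeat (case: ifP => ?); lia.
- move=> i ltim; have [->|neq_im] := eqVneq i m.-1.
    by have := lt_f m.-1; rewrite wm; repeat (case: ifP => ?); lia.
  by rewrite -desc_f; last lia; repeat (case: ifP => ?); lia.
- by move=> i ltim; have := lt_g i; repeat (case: ifP => ?); lia.
- move=> i j ltim ltjm; have := lt_g i; have := lt_g j; have := inj_g i j.
  by repeat (case: ifP => ?); lia.
- move=> i ltim; have [->|neq_im] := eqVneq i m.-1.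
    by rewrite wm; repeat (case: ifP => ?); lia.
  have := inj_g i i.+1; have := lt_g i; have := lt_g i.+1.
  by rewrite -desc_g; last lia; repeat (case: ifP => ?); lia.
- move=> i ltim; have := lt_f i; have := lt_g i; have := neq i.
  by repeat (case: ifP => ?); lia.
Qed.

Lemma deranged_last m w : 0 < m -> deranged m w -> deranged m.+1 w.
Proof.
move=> m_gt0 dw; case wm: (w m.-1); last exact: deranged_ascent.
apply: (@eq_deranged _ (fun i => ~~ ~~ w i)) => [i _|]; first exact: negbK.
by apply/deranged_compl/deranged_ascent; rewrite ?wm //; apply: deranged_compl.
Qed.

(** Reversal makes the first letter the last, which [deranged_last] can add; a second reversal
    restores the word. *)
Lemma deranged_first m w :
  0 < m -> deranged m (fun i => w i.+1) -> deranged m.+1 w.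
Proof.
move=> m_gt0 dw.
have dr: deranged m.+1 (fun i => ~~ w (m.+1 - i.+2)).
  apply: deranged_last => //; apply: eq_deranged (deranged_rev dw) => i ltim.
  by congr (~~ w _); lia.
apply: eq_deranged (deranged_rev dr) => i ltim.
by rewrite negbK; congr w; lia.
Qed.

(** The letters before the factor are added one by one on the left, by induction on [p] for all [w],
    then those after it on the right. *)
Lemma deranged_factor p m n w :
  0 < m -> p + m <= n -> deranged m (fun i => w (p + i)) -> deranged n w.
Proof.
move=> m_gt0 le_n dw.
have {dw}: deranged (p + m) w.
  elim: p w le_n dw => [|p IHp] w le_n dw; first by [].
  rewrite addSn; apply: deranged_first; first lia.
  by apply: IHp; [lia | apply: eq_deranged dw].
rewrite -(subnKC le_n); elim: (n - _) => [|q IHq] dw; first by rewrite addn0.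
by rewrite addnS; apply: deranged_last; [lia | apply: IHq].
Qed.

(** * Words with at least two turns *)

(** In one-line notation the witnesses are [0, k+1, ..., 1, k+2] and [1, k+2, ..., 3, 0, 2]. *)
Lemma deranged_ascent_descents_ascent k :
  0 < k -> deranged k.+3 (fun i => 0 < i <= k).
Proof.
move=> k_gt0.
exists (fun i => if (i == 0) || (i == k.+2) then i else k.+2 - i).
exists (fun i => if i == 0 then 1 else if i <= k then k.+3 - i
                 else if i == k.+1 then 0 else 2).
split; [split | split | ].
- by move=> i; case: ifP; lia.
- by move=> i j; repeat (case: ifP => ?); lia.
- by move=> i; repeat (case: ifP => ?); lia.
- by move=> i; repeat (case: ifP => ?); lia.
- by move=> i j; repeat (case: ifP => ?); lia.
- by move=> i; repeat (case: ifP => ?); lia.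
- by move=> i; repeat (case: ifP => ?); lia.
Qed.

(** Let [a] be the first position whose letter differs from [w 0]. If [w 0] recurs after [a], first
    at [b], then the letters from [a.-1] to [b] form a factor A D^k A or D A^k D with [k = b - a].
    Otherwise the word turns only once, at [a]. *)
Lemma nonconstant_word_cases n w :
  (exists2 i, i < n.-1 & w i != w 0) ->
  (exists2 k, 0 < k < n.-1 &
     forall i, i < n.-1 -> w i = (if i < k then w 0 else ~~ w 0))
  \/ deranged n w.
Proof.
case=> i0 lt_i0 w_i0; have exa: exists i, w i != w 0 by exists i0.
case: (ex_minnP exa) => a wa min_a.
have w_lt_a i: i < a -> w i = w 0.
  by move=> ltia; apply/eqP; apply: contraTT ltia => /min_a; lia.
have a_gt0: 0 < a by case: a wa {min_a w_lt_a}; rewrite ?eqxx.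
have lt_a: a < n.-1 by have := min_a _ w_i0; lia.
have {}wa: w a = ~~ w 0 by case: (w a) (w 0) wa => [] [].
have [|/hasPn no_b] := boolP (has (fun i => (a < i) && (w i == w 0)) (iota 0 n.-1)).
  move=> /hasP[b1]; rewrite mem_iota add0n /= => lt_b1 /andP[lt_ab1 wb1].
  have exb: exists b, (a < b) && (w b == w 0) by exists b1; rewrite lt_ab1.
  case: (ex_minnP exb) => b /andP[lt_ab /eqP wb] min_b.
  have lt_b: b < n.-1 by have := min_b b1; rewrite lt_ab1 wb1; lia.
  have w_ab i: a <= i < b -> w i = ~~ w 0.
    move=> /andP[le_ai lt_ib]; have [<-//|neq_ai] := eqVneq a i.
    have := min_b i; rewrite [a < i]ltn_neqAle neq_ai le_ai /=.
    by case: (w i) (w 0) => [] [] //= /(_ isT); lia.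
  (* The factor has [b - a + 2] letters, hence one more position. *)
  right; apply: (@deranged_factor a.-1 (b - a).+3); [lia|lia|].
  have base: deranged (b - a).+3 (fun i => 0 < i <= b - a).
    by apply: deranged_ascent_descents_ascent; lia.
  have w_eq i: i.+1 < (b - a).+3 ->
      w (a.-1 + i) = (if 0 < i <= b - a then ~~ w 0 else w 0).
    move=> lt_i; case: ifP => [in_i|nin_i]; first by apply: w_ab; lia.
    have [->|i_neq0] := eqVneq i 0; first by apply: w_lt_a; lia.
    by rewrite -wb; congr w; lia.
  (* If [w 0] is a descent, the factor is the complement of the one in [base]. *)
  case w0: (w 0) w_eq => w_eq; last first.
    by apply: eq_deranged base => i /w_eq ->; case: ifP.
  by apply: eq_deranged (deranged_compl base) => i /w_eq ->; case: ifP.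
left; exists a => [|i lt_i]; first by rewrite a_gt0.
case: ltnP => [/w_lt_a //|le_ai]; have [<-//|neq_ai] := eqVneq a i.
have := no_b i; rewrite mem_iota /= add0n lt_i [a < i]ltn_neqAle neq_ai le_ai /=.
by case: (w i) (w 0) => [] [] //= /(_ isT).
Qed.

(** * Words with a single turn *)

(** Values grow when moving away from [k] on either side, by induction on the distance to [k]. *)
Lemma valley_min n k f i :
  realizes n (fun j => j < k) f -> k < n -> i < n -> f k <= f i.
Proof.
case=> _ _ desc_f ltkn ltin.
have [le_ik|/ltnW le_ki] := leqP i k.
  have: forall d, d <= k -> f k <= f (k - d).
    elim=> [|d IHd] lt_dk; first by rewrite subn0.
    apply: leq_trans (IHd (ltnW lt_dk)) _; have := desc_f (k - d.+1).
    have ->: (k - d.+1).+1 = k - d by lia.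
    by lia.
  by move/(_ (k - i)); rewrite subKn // leq_subr; apply.
rewrite -(subnKC le_ki) in ltin *; move: ltin.
elim: (i - k) => [|d IHd]; rewrite ?addn0 // addnS => lt_n.
by apply: leq_trans (IHd (ltnW lt_n)) _; have := desc_f _ lt_n; lia.
Qed.

(** The witnesses are [k, ..., 0, k+1, ..., n-1] and [n-1, ..., n-k, 0, ..., n-1-k]. *)
Lemma valley_pair n k :
  0 < k < n.-1 -> exists f g,
    [/\ realizes n (fun i => i < k) f, realizes n (fun i => i < k) g
      & forall i, i < n -> i != k -> f i <> g i].
Proof.
move=> ltkn.
exists (fun i => if i <= k then k - i else i).
exists (fun i => if i < k then n.-1 - i else i - k).
split; [split | split | ].
- by move=> i; repeat (case: ifP => ?); lia.
- by move=> i j; repeat (case: ifP => ?); lia.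
- by move=> i; repeat (case: ifP => ?); lia.
- by move=> i; repeat (case: ifP => ?); lia.
- by move=> i j; repeat (case: ifP => ?); lia.
- by move=> i; repeat (case: ifP => ?); lia.
- by move=> i; repeat (case: ifP => ?); lia.
Qed.

(** * From descent sets to words and from functions to permutations *)

(** The indicator of [S], extended by [false] to all of [nat]. *)
Definition word_of m (S : {set 'I_m}) (i : nat) : bool :=
  [exists k in S, val k == i].

Lemma word_ofE m (S : {set 'I_m}) (k : 'I_m) : word_of S k = (k \in S).
Proof.
apply/exists_inP/idP => [[j jS /eqP/val_inj <-]//|kS]; by exists k.
Qed.

Lemma descent_class_realizes n (S : {set 'I_n}) (s : 'S_n.+1) :
  s \in @descent_class n.+1 S <-> realizes n.+1 (word_of S) (fun i => s (inord i)).
Proof.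
have inord_pos (k : 'I_n): inord k = @pos n.+1 k.
  by apply/val_inj; rewrite /= inordK // ltnS ltnW.
have inord_next (k : 'I_n): inord k.+1 = @next_pos n.+1 k.
  by apply/val_inj; rewrite /= inordK ?ltnS // /bump leqnn.
rewrite inE; split=> [/eqP defS|[_ _ desc_s]].
  split=> [i _|i j ltin ltjn|i ltin]; first exact: ltn_ord.
    by move/val_inj/perm_inj/(congr1 val); rewrite /= !inordK.
  have -> : i = Ordinal (ltin : i < n) by [].
  by rewrite word_ofE -defS inE inord_pos inord_next.
apply/eqP/setP=> k; rewrite inE -word_ofE -desc_s ?ltnS //.
by rewrite inord_pos inord_next.
Qed.

Lemma realizes_perm n (S : {set 'I_n}) f :
  realizes n.+1 (word_of S) f ->
  exists2 s : 'S_n.+1, s \in @descent_class n.+1 S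
    & forall i : 'I_n.+1, s i = f i :> nat.
Proof.
move=> rf; have [lt_f inj_f _] := rf.
have inj: injective (fun i : 'I_n.+1 => inord (f i) : 'I_n.+1).
  by move=> i j /(congr1 val); rewrite /= !inordK ?lt_f // => /inj_f/val_inj->.
have sE i: perm inj i = f i :> nat by rewrite permE inordK ?lt_f.
exists (perm inj) => //; apply/descent_class_realizes; case: rf => [_ _ desc_f].
split=> [i _|i j ltin ltjn|i ltin]; first exact: ltn_ord.
  by rewrite !sE !inordK //; apply: inj_f.
by rewrite !sE !inordK ?desc_f // ltnW.
Qed.

(** * Single turns and end intervals *)

(** D^k A^l if [c] holds, A^k D^l otherwise. *)
Definition turn k c (i : nat) : bool := if i < k then c else ~~ c.

Lemma turn_pair n k c :
  0 < k < n.-1 -> exists f g,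
    [/\ realizes n (turn k c) f, realizes n (turn k c) g
      & forall i, i < n -> i != k -> f i <> g i].
Proof.
move=> ltkn; have [f [g [rf rg neq]]] := valley_pair ltkn.
case: c.
  exists f, g; split=> //.
    by apply: eq_realizes rf => i _; rewrite /turn; case: ltnP.
  by apply: eq_realizes rg => i _; rewrite /turn; case: ltnP.
exists (fun i => n.-1 - f i), (fun i => n.-1 - g i); split.
- by apply: eq_realizes (realizes_compl rf) => i _; rewrite /turn; case: ltnP.
- by apply: eq_realizes (realizes_compl rg) => i _; rewrite /turn; case: ltnP.
case: rf rg => [lt_f _ _] [lt_g _ _] i ltin neq_ik.
by have := neq i ltin neq_ik; have := lt_f i ltin; have := lt_g i ltin; lia.
Qed.

Lemma turn_value n k c (s : 'S_n.+1) :
  k < n.+1 -> realizes n.+1 (turn k c) (fun i => s (inord i)) ->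
  s (inord k) = if c then ord0 else ord_max.
Proof.
move=> lt_kn rs; apply/val_inj; case: c rs => rs /=.
  have {}rs: realizes n.+1 (fun i => i < k) (fun i => s (inord i)).
    by apply: eq_realizes rs => i _; rewrite /turn; case: ltnP.
  (* Compare the turning point with the position of the value 0; a peak is handled the same way
     after complement. *)
  have := valley_min rs lt_kn (ltn_ord (s^-1%g ord0)).
  by rewrite inord_val permKV leqn0 => /eqP.
have {}rs: realizes n.+1 (fun i => i < k) (fun i => n - s (inord i)).
  by apply: eq_realizes (realizes_compl rs) => i _; rewrite /turn; case: ltnP.
have := valley_min rs lt_kn (ltn_ord (s^-1%g ord_max)).
rewrite inord_val permKV /= subnn.
by have := ltn_ord (s (inord k)); lia.
Qed.

Lemma end_interval_turn n (S : {set 'I_n}) :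
  S \proper [set: 'I_n] -> @end_interval n.+1 S ->
  exists k c, 0 < k < n /\ forall i, i < n -> word_of S i = turn k c i.
Proof.
move=> /properP[_ [[x lt_x] _ xS]] /existsP[[i lt_i] /existsP[[j lt_j] /and3P[]]].
move=> /= le_ij /eqP defS ends; rewrite defS inE /= in xS.
have wE l: l < n -> word_of S l = (i <= l <= j).
  by move=> ltl; rewrite -[l]/(val (Ordinal ltl)) word_ofE defS inE.
have [i0|i_gt0] := posnP i.
  (* The element [x] outside [S] gives [j.+1 < n]. *)
  exists j.+1, true; split=> [|l ltl]; first by lia.
  by rewrite wE // i0 /turn ltnS leq0n; case: leqP.
have j_last: j.+1 = n by lia.
exists i, false; split=> [|l ltl]; first by lia.
by rewrite wE // /turn; case: ltnP; lia.
Qed.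

Lemma turn_end_interval n (S : {set 'I_n}) k c :
  0 < k < n -> (forall i, i < n -> word_of S i = turn k c i) ->
  @end_interval n.+1 S.
Proof.
case: n S => [|n] S lt_k wE; first by lia.
have lt_k1 : k.-1 < n.+1 by lia.
have lt_k0 : k < n.+1 by lia.
have memS (l : 'I_n.+1): (l \in S) = turn k c l by rewrite -word_ofE wE.
apply/existsP; exists (if c then ord0 else Ordinal lt_k0).
apply/existsP; exists (if c then Ordinal lt_k1 else ord_max).
case: c {wE} memS => memS; apply/and3P; split => //=; try lia.
  by apply/eqP/setP=> l; rewrite memS inE /turn /=; case: ltnP; lia.
by apply/eqP/setP=> -[l lt_l]; rewrite memS inE /turn /=; case: ltnP; lia.
Qed.

Lemma nonconstant_word_of n (S : {set 'I_n}) :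
  S != set0 -> S \proper [set: 'I_n] ->
  exists2 i, i < n & word_of S i != word_of S 0.
Proof.
move=> /set0Pn[x xS] /properP[_ [y _ yS]].
case w0: (word_of S 0); first by exists y; rewrite // word_ofE (negPf yS).
by exists x; rewrite // word_ofE xS.
Qed.

Theorem theorem3p2 (n : nat) (S : {set 'I_n.-1}) (hn : 3 <= n)
    (hS0 : S != set0) (hS1 : S \proper [set: 'I_n.-1]) :
  \max_(p : 'S_n * 'S_n | [&& p.1 \in descent_class S, p.2 \in descent_class S
                            & p.1 != p.2])
     hamming p.1 p.2
  = if end_interval S then n.-1 else n.
Proof.
case: n S hn hS0 hS1 => [//|n] S n_ge3 S_neq0 S_proper.
(* Lower bounds come from two realizations that differ on [A]; [0 < m] makes the resulting
   permutations distinct. *)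
have attain m (f g : nat -> nat) (A : {set 'I_n.+1}):
    realizes n.+1 (word_of S) f -> realizes n.+1 (word_of S) g ->
    0 < m <= #|A| -> {in A, forall i : 'I_n.+1, f i <> g i} ->
  m <= \max_(p : 'S_n.+1 * 'S_n.+1 |
         [&& p.1 \in @descent_class n.+1 S, p.2 \in @descent_class n.+1 S
           & p.1 != p.2]) hamming p.1 p.2.
  move=> /realizes_perm[s sS sE] /realizes_perm[r rS rE] /andP[m_gt0 le_mA] neq.
  have le_m: m <= hamming s r.
    apply: leq_trans le_mA (subset_leq_card _); apply/subsetP=> i /neq neq_i.
    by rewrite inE; apply/eqP=> /(congr1 val); rewrite /= sE rE.
  apply: (leq_trans le_m); apply: (@leq_bigmax_cond _ _ _ (s, r)).
  rewrite /= sS rS /=; apply/eqP=> eq_sr; have := leq_trans m_gt0 le_m.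
  rewrite eq_sr /hamming (_ : [set _ | _] = set0) ?cards0 //.
  by apply/setP=> i; rewrite !inE eqxx.
apply/eqP; rewrite eqn_leq; apply/andP; split.
  apply/bigmax_leqP=> -[s r] /= /and3P[sS rS _].
  (* The bound [n.+1] is trivial. For an end interval, all members of the class agree at the turning
     point [k], which saves one. *)
  case: ifP => [endS|_]; last by rewrite -[X in _ <= X]card_ord max_card.
  have [k [c [lt_k wE]]] := end_interval_turn S_proper endS.
  have lt_kn: k < n.+1 by lia.
  have sk (t : 'S_n.+1) (tS : t \in @descent_class n.+1 S) :=
    turn_value lt_kn (@eq_realizes n.+1 _ _ _ wE
      (iffLR (descent_class_realizes S t) tS)).
  apply: leq_trans (_ : #|[set~ inord k : 'I_n.+1]| <= _).
    apply/subset_leq_card/subsetP=> i; rewrite !inE.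
    by apply: contraNneq => ->; rewrite !sk.
  by rewrite cardsC1 card_ord.
case: ifP => [endS|not_endS].
  have [k [c [lt_k wE]]] := end_interval_turn S_proper endS.
  have [f [g [rf rg neq]]] := @turn_pair n.+1 k c lt_k.
  have wE' i: i.+1 < n.+1 -> turn k c i = word_of S i by move=> /wE.
  apply: (attain _ f g [set~ inord k]).
  - exact: eq_realizes wE' rf.
  - exact: eq_realizes wE' rg.
  - by rewrite cardsC1 card_ord /=; lia.
  - move=> i; rewrite !inE => neq_ik; apply: neq; first exact: ltn_ord.
    by apply: contraNneq neq_ik => <-; rewrite inord_val.
have nonconst := nonconstant_word_of S_neq0 S_proper.
(* A single turn would make [S] an end interval, so a pair that differs everywhere exists. *)
case: (@nonconstant_word_cases n.+1 _ nonconst) => [[k lt_k wE]|[f [g [rf rg neq]]]].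
  by rewrite (turn_end_interval lt_k wE) in not_endS.
apply: (attain _ f g setT rf rg) => [|i _]; last exact: neq.
by rewrite cardsT card_ord leqnn.
Qed.
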